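(* For all integers $a$ and $d$ with $2 \leq a \leq d+1$, there exists a positive constant $c_{a,d}$ such that for all positive integers $n$, $$h_{a,d}(n) \geq c_{a,d}\, n^{\frac{1}{(2a-1)d}}.$$
   Context: For a set of $a$ points in $\mathbb{R}^d$, its volume is the $(a-1)$-dimensional volume of the simplex spanned by the $a$ points (this is zero if the points lie in a common $(a-2)$-dimensional affine subspace). For positive integers $a \ge 2$, $d$, $n$, $h_{a,d}(n)$ denotes the largest integer $t$ such that every set of $n$ points in $\mathbb{R}^d$ contains a subset of $t$ points for which all the non-zero volumes of the $\binom{t}{a}$ subsets of order $a$ are distinct (subsets of volume zero are disregarded). *)

(* Defs.v *)
From mathcomp Require Import all_boot all_order all_algebra finmap.
From mathcomp Require Import boolp reals.

Set Implicit Arguments.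
Unset Strict Implicit.
Unset Printing Implicit Defensive.

Import Order.TTheory GRing.Theory Num.Theory.
Local Open Scope ring_scope.
Local Open Scope fset_scope.

Definition edge_mx (R : realType) (d k : nat) (p : 'I_k.+1 -> 'rV[R]_d) :
    'M[R]_(k, d) :=
  \matrix_(i < k, j < d) (p (lift ord0 i) 0 j - p ord0 0 j).

(* k-dimensional Euclidean volume of the simplex with vertices p 0, ..., p k:
   the volume of the parallelotope spanned by the edges at p 0 is the square
   root of their Gram determinant, and the simplex is 1/k! of it. *)
Definition simplex_volume (R : realType) (d k : nat)
    (p : 'I_k.+1 -> 'rV[R]_d) : R :=
  Num.sqrt (\det (edge_mx p *m (edge_mx p)^T)) / k`!%:R.

(* The vertices are read off the enumeration of A; the order does not matter,
   since reordering multiplies the edge matrix on the left by a matrix of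
   determinant 1 or -1. Only meaningful for A nonempty. *)
Definition volume (R : realType) (d : nat) (A : {fset 'rV[R]_d}) : R :=
  simplex_volume (fun i : 'I_(#|` A|.-1.+1) => (enum_fset A)`_i).

Definition distinct_volumes (R : realType) (a d : nat)
    (T : {fset 'rV[R]_d}) : Prop :=
  forall A B : {fset 'rV[R]_d},
    A `<=` T -> B `<=` T -> #|` A| = a -> #|` B| = a ->
    volume A != 0 -> volume B != 0 -> A != B -> volume A != volume B.

Definition unavoidable (R : realType) (a d n t : nat) : Prop :=
  forall S : {fset 'rV[R]_d}, #|` S| = n ->
    exists T : {fset 'rV[R]_d},
      [/\ T `<=` S, #|` T| = t & distinct_volumes a T].

(* The maximum may be taken over t <= n because, for 0 < d, a set of n points
   exists and has no subset with more than n points; t = 0 always qualifies. *)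
Definition h (R : realType) (a d n : nat) : nat :=
  (\max_(t < n.+1 | `[< unavoidable R a d n t >]) t)%N.

(* Main.v *)
(* Replace distinct volumes of a-sets by distinct volumes of b-sets for all
   2 <= b <= a at once. If T is a maximal such subset of Z, with t points, then
   every point x of Z solves one of O(t^(2a-1)) polynomial equations of degree at
   most 2a: vol(x,A) = vol(x,B) or vol(x,A) = vol(Q) with A, B, Q in T, or x in T.
   None of these holds on all of Z: putting x in A and then in B shows that A and
   B span the same flat, hence are smaller sets with equal volumes. So one of the
   equations is satisfied by a fraction t^(1-2a) of Z.

   If Z lay on an irreducible variety, passing to the solutions would lower its
   dimension, so that this happens at most d times and n = O(t^((2a-1)d)). In
   place of varieties we use the Hilbert function H_Z(m), the dimension of the
   space of polynomials of degree at most m restricted to Z. If no two low degree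
   polynomials f, g that are nonzero on Z satisfy f g = 0 on Z, then
   H_{Z, f = 0}(m + e) <= H_Z(m + e) - H_Z(m), and summing over m lowers the degree of
   growth of H by one; otherwise Z is covered by f = 0 and g = 0, and one passes
   to the larger half, which can happen a bounded number of times only. *)
Require Import Defs.
From mathcomp Require Import all_boot all_order all_fingroup all_algebra finmap.
From mathcomp Require Import boolp reals exp zify ring.

Set Implicit Arguments.
Unset Strict Implicit.
Unset Printing Implicit Defensive.

Import Order.TTheory GRing.Theory Num.Theory.
Local Open Scope ring_scope.

(** * Hilbert functions of finite sets *)

Section HilbertFunction.
Variables (K : fieldType) (n : nat) (r : nat -> nat).
(** Functions on n points are row vectors, with pointwise product [f *m diag_mx g]; the row space of
    [F m] stands for those of degree at most m. *)
Variable F : forall m, 'M[K]_(r m, n).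
Hypothesis F1 : forall m, ((const_mx 1 : 'rV_n) <= F m)%MS.
Hypothesis FM : forall m m' (f g : 'rV_n), (f <= F m)%MS -> (g <= F m')%MS ->
  (f *m diag_mx g <= F (m + m'))%MS.

Implicit Types (Z : {set 'I_n}) (f g : 'rV[K]_n) (m e J : nat).

(** Restriction keeps all n coordinates and zeroes those outside Z, so that successive restrictions
    compose as square matrices. *)
Definition restr Z : 'M[K]_n := diag_mx (\row_i (i \in Z)%:R).
Definition vanish f Z := [forall i in Z, f 0 i == 0].
Definition zeros Z f := [set i in Z | f 0 i == 0].
Definition hilb Z m := \rank (F m *m restr Z).

Lemma mul_restrE p (A : 'M[K]_(p, n)) Z i j :
  (A *m restr Z) i j = A i j * (j \in Z)%:R.
Proof. by rewrite mul_mx_diag !mxE. Qed.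

Lemma vanishP f Z : reflect (f *m restr Z = 0) (vanish f Z).
Proof.
apply: (iffP forall_inP) => [fZ|fZ i iZ].
  apply/rowP=> i; rewrite mul_restrE mxE.
  by case: (boolP (i \in Z)) => [/fZ/eqP->|_]; rewrite ?mul0r ?mulr0.
by have /rowP/(_ i) := fZ; rewrite mul_restrE mxE iZ mulr1 => ->.
Qed.

Lemma zerosS Z f : zeros Z f \subset Z.
Proof. by apply/subsetP=> i; rewrite inE => /andP[]. Qed.

Lemma restr_sub p (A : 'M[K]_(p, n)) Z Z' :
  Z' \subset Z -> A *m restr Z *m restr Z' = A *m restr Z'.
Proof.
move=> /subsetP sZ; apply/matrixP=> i j; rewrite !mul_restrE.
by case: (boolP (j \in Z')) => [/sZ->|_]; rewrite ?mulr0 ?mulr1.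
Qed.

Lemma F_mono m e : (F m <= F (m + e))%MS.
Proof.
apply/row_subP=> i.
have := FM (row_sub i (F m)) (F1 e).
by rewrite diag_const_mx mulmx1.
Qed.

Lemma hilb_mono Z m m' : (m <= m')%N -> (hilb Z m <= hilb Z m')%N.
Proof. by move=> /subnKC <-; apply: mxrankS; apply: submxMr; apply: F_mono. Qed.

Lemma hilb_sub Z Z' m : Z' \subset Z -> (hilb Z' m <= hilb Z m)%N.
Proof. by move=> sZ; rewrite /hilb -(restr_sub _ sZ) mxrankM_maxl. Qed.

Lemma hilb_gt0 Z m : (0 < #|Z|)%N -> (0 < hilb Z m)%N.
Proof.
case/card_gt0P => i iZ.
have := submxMr (restr Z) (F1 m) => /mxrankS; apply: leq_trans.
rewrite lt0n mxrank_eq0; apply/eqP=> /rowP/(_ i).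
by rewrite mul_restrE !mxE iZ mulr1; apply/eqP/oner_neq0.
Qed.

(** Restricting further from Z to the zeros of f kills f, which is nonzero on Z, so the rank
    drops. *)
Lemma hilb_zeros Z f m : (f <= F m)%MS -> ~~ vanish f Z ->
  (hilb (zeros Z f) m < hilb Z m)%N.
Proof.
move=> fF nfZ; rewrite /hilb -(restr_sub _ (zerosS Z f)).
rewrite -[X in (_ < X)%N](mxrank_mul_ker _ (restr (zeros Z f))).
rewrite -[X in (X < _)%N]addn0 ltn_add2l lt0n mxrank_eq0 -submx0.
apply: contra nfZ => ker0; apply/vanishP/eqP; rewrite -submx0.
apply: submx_trans ker0; rewrite sub_capmx submxMr //=.
apply/sub_kermxP; rewrite restr_sub ?zerosS //; apply/vanishP/forall_inP => i.
by rewrite inE => /andP[].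
Qed.

(** Rank-nullity for the restriction from Z to the zeros of f: the kernel contains f times [F m],
    and multiplication by f is injective there. *)
Lemma hilb_nonzerodivisor Z f m e : (f <= F e)%MS ->
    (forall g, (g <= F m)%MS -> vanish (g *m diag_mx f) Z -> vanish g Z) ->
  (hilb (zeros Z f) (m + e) + hilb Z m <= hilb Z (m + e))%N.
Proof.
move=> fF nzd; rewrite {1 3}/hilb -(restr_sub _ (zerosS Z f)).
rewrite -[X in (_ <= X)%N](mxrank_mul_ker _ (restr (zeros Z f))) leq_add2l.
have restrC Z' : diag_mx f *m restr Z' = restr Z' *m diag_mx f.
  by rewrite /restr !mulmx_diag; congr diag_mx; apply/rowP=> i; rewrite !mxE mulrC.
have <- : \rank (F m *m restr Z *m diag_mx f) = hilb Z m.
  rewrite -[RHS](mxrank_mul_ker _ (diag_mx f)); apply/eqP.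
  rewrite -{1}[\rank (_ *m diag_mx f)]addn0 eqn_add2l eq_sym mxrank_eq0 -submx0.
  apply/row_subP=> i; move: (row_sub i (F m *m restr Z :&: kermx (diag_mx f))%MS).
  rewrite sub_capmx => /andP[/submxP[D ->] /sub_kermxP]; rewrite mulmxA => Df0.
  rewrite submx0; apply/eqP/vanishP/nzd; first exact: submxMl.
  by apply/vanishP; rewrite -mulmxA restrC mulmxA.
apply: mxrankS; rewrite sub_capmx; apply/andP; split.
  rewrite -mulmxA -restrC mulmxA submxMr //; apply/row_subP=> i.
  by rewrite row_mul; apply: FM => //; apply: row_sub.
apply/sub_kermxP; rewrite -mulmxA restrC mulmxA restr_sub ?zerosS // -mulmxA -restrC.
suff -> : diag_mx f *m restr (zeros Z f) = 0 by rewrite mulmx0.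
apply/matrixP=> i j; rewrite mul_restrE !mxE inE.
have [->|_] := eqVneq i j; last by rewrite mulr0n mul0r.
by have [->|_] := eqVneq (f 0 j) 0; rewrite ?mul0rn ?mul0r ?andbF ?mulr0.
Qed.

(** Irreducibility of Z as seen by factors of bounded degree. *)
Definition domain_on Z e m := forall f g, (f <= F e)%MS -> (g <= F m)%MS ->
  vanish (g *m diag_mx f) Z -> vanish f Z \/ vanish g Z.

(* As long as some product f g vanishes on Z although neither factor does, Z is
   covered by the zeros of f and those of g; the larger half has a smaller
   Hilbert function. *)
Lemma domain_subset Z e m : (0 < #|Z|)%N ->
  exists Z1, [/\ Z1 \subset Z, (0 < #|Z1|)%N,
    (#|Z| <= 2 ^ hilb Z (e + m) * #|Z1|)%N & domain_on Z1 e m].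
Proof.
move: {2}(hilb Z _).+1 (ltnSn (hilb Z (e + m))) => N.
elim: N Z => // N IH Z leN Z0.
have [dom|] := pselect (domain_on Z e m).
  by exists Z; split=> //; rewrite leq_pmull // expn_gt0.
move=> /existsNP[f] /existsNP[g] /not_implyP[fF] /not_implyP[gF].
move=> /not_implyP[fgZ] /not_orP[/negP nf /negP ng].
suff [Z' [sZ ltH leZ]] : exists Z', [/\ Z' \subset Z,
    (hilb Z' (e + m) < hilb Z (e + m))%N & (#|Z| <= 2 * #|Z'|)%N].
  have Z'0 : (0 < #|Z'|)%N by rewrite lt0n; apply: contraTneq leZ => ->; rewrite muln0 -ltnNge.
  have [Z1 [s1 p1 l1 d1]] := IH Z' (leq_trans ltH leN) Z'0.
  exists Z1; split => //; first exact: subset_trans s1 sZ.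
  apply: (leq_trans leZ); rewrite (leq_trans (leq_mul (leqnn 2) l1)) // mulnA -expnS.
  by rewrite leq_mul2r leq_exp2l // ltH orbT.
have cov : Z = zeros Z f :|: zeros Z g.
  apply/setP=> i; rewrite !inE -andb_orr; case: (boolP (i \in Z)) => //= iZ.
  have /forall_inP/(_ i iZ) := fgZ.
  by rewrite mul_mx_diag mxE mulf_eq0 orbC.
have fL := submx_trans fF (F_mono e m).
have gL : (g <= F (e + m))%MS by rewrite addnC; apply: submx_trans gF (F_mono m e).
have : (#|Z| <= #|zeros Z f| + #|zeros Z g|)%N by rewrite {1}cov cardsU leq_subr.
case: (leqP #|zeros Z f| #|zeros Z g|) => cmp leZ.
  by exists (zeros Z g); rewrite zerosS hilb_zeros //; split=> //; lia.
by exists (zeros Z f); rewrite zerosS hilb_zeros //; split=> //; lia.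
Qed.

(** Telescoping: the term in degree e(j+1) is at most the increment of [hilb Z] from ej to e(j+1).
    Cofactors reach degree e(J-1), whence [J.-1]. *)
Lemma hilb_domain_sum Z e J f : domain_on Z e (e * J.-1) -> (f <= F e)%MS ->
    ~~ vanish f Z ->
  (\sum_(j < J) hilb (zeros Z f) (e * j.+1) <= hilb Z (e * J))%N.
Proof.
move=> dom fF nf.
suff: forall J', (J' <= J)%N ->
  (\sum_(j < J') hilb (zeros Z f) (e * j.+1) <= hilb Z (e * J'))%N by apply.
elim=> [|J' IH] leJ; first by rewrite big_ord0.
rewrite big_ord_recr /= addnC (leq_trans (leq_add (leqnn _) (IH (ltnW leJ)))) //.
rewrite mulnS addnC [X in (_ <= hilb _ X)%N]addnC addnC.
rewrite [X in hilb (zeros _ _) X]addnC.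
apply: hilb_nonzerodivisor => // g gF /dom []//; last by rewrite (negPf nf).
have /subnKC <- : (e * J' <= e * J.-1)%N by rewrite leq_mul2l; lia.
exact: submx_trans gF (F_mono _ _).
Qed.

(** Only the upper half of the sum is kept: J terms of degree at least eJ, with [hilb] monotone in
    the degree. *)
Lemma hilb_domain_half Z e J f : domain_on Z e (e * (2 * J).-1) -> (f <= F e)%MS ->
    ~~ vanish f Z ->
  (J * hilb (zeros Z f) (e * J) <= hilb Z (e * (2 * J)))%N.
Proof.
move=> dom fF nf; apply: leq_trans (hilb_domain_sum dom fF nf).
rewrite -(big_mkord xpredT (fun j => hilb _ (e * j.+1))) (@big_cat_nat _ _ _ J) //=; last by lia.
apply: leq_trans (leq_addl _ _); rewrite -[X in (X * _ <= _)%N](_ : 2 * J - J = J)%N; last by lia.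
rewrite -sum_nat_const_nat; rewrite big_nat [X in (_ <= X)%N]big_nat.
apply: leq_sum => j /andP[lj _].
by rewrite hilb_mono // leq_mul2l (leq_trans lj) ?orbT.
Qed.

Section Bound.
Variables (e w C N : nat).
Hypotheses (w0 : (0 < w)%N) (CN : (C < N)%N).
Hypothesis popular_zeros : forall Z, (1 < #|Z|)%N ->
  exists f, [/\ (f <= F e)%MS, ~~ vanish f Z & (#|Z| <= w * #|zeros Z f|)%N].

Lemma domain_part Z J : (0 < J)%N -> (0 < #|Z|)%N ->
  exists Z1, [/\ Z1 \subset Z, (0 < #|Z1|)%N,
    (#|Z| <= 2 ^ hilb Z (e * J) * #|Z1|)%N & domain_on Z1 e (e * J.-1)].
Proof.
by move=> J0 Z0; have := @domain_subset Z e (e * J.-1) Z0; rewrite -mulnS prednK.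
Qed.

(* Each passage to a popular zero set lowers the degree of growth of the
   Hilbert function by one, at the cost of one factor w. *)
Lemma card_bound_growth (b k : nat) Z : (C * N ^ k <= b)%N -> (0 < #|Z|)%N ->
  (hilb Z (e * (2 ^ k * N)) <= C * N ^ k)%N ->
  (#|Z| <= (2 ^ b) ^ k.+1 * w ^ k)%N.
Proof.
have N0 : (0 < N)%N by lia.
(* The same b dominates [C * N ^ k] at all levels of the induction, so each passage to a domain
   costs at most a factor [2 ^ b]. *)
elim: k Z => [|k IH] Z leb Z0 leH.
  move: leH leb; rewrite expn0 mul1n !muln1 expn1 => leH leb.
  have [Z1 [s1 p1 l1 dom]] := domain_part N0 Z0.
  have [gt1|le1] := ltnP 1 #|Z1|; last first.
    apply: leq_trans l1 _; rewrite -[X in (_ <= X)%N]muln1 leq_mul // leq_exp2l //.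
    exact: leq_trans leb.
  have [f [fF nf leZ]] := popular_zeros gt1.
  (* A nonempty zero set contributes at least 1 in each of N degrees, exceeding the bound C; so [Z1]
     must be a single point. *)
  have Zf0 : (0 < #|zeros Z1 f|)%N.
    by rewrite lt0n; apply: contraTneq leZ => ->; rewrite muln0; lia.
  have := hilb_domain_sum dom fF nf.
  have : (N <= \sum_(j < N) hilb (zeros Z1 f) (e * j.+1))%N.
    rewrite -[X in (X <= _)%N]muln1 -[X in (X * _ <= _)%N]card_ord -sum_nat_const.
    by apply: leq_sum => j _; apply: hilb_gt0.
  have := hilb_sub (e * N) s1; lia.
have leb' : (C * N ^ k <= b)%N.
  by apply: leq_trans leb; rewrite leq_mul2l leq_pexp2l ?orbT.
have J0 : (0 < 2 ^ k.+1 * N)%N by rewrite muln_gt0 expn_gt0.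
have [Z1 [s1 p1 l1 dom]] := domain_part J0 Z0.
have l1b : (#|Z| <= 2 ^ b * #|Z1|)%N.
  apply: leq_trans l1 _; rewrite leq_mul2r leq_exp2l // (leq_trans leH leb) orbT //.
apply: (leq_trans l1b).
rewrite expnS -mulnA leq_mul2l; apply/orP; right.
have [gt1|le1] := ltnP 1 #|Z1|; last first.
  by apply: leq_trans le1 _; rewrite muln_gt0 !expn_gt0 w0.
have [f [fF nf leZ]] := popular_zeros gt1.
apply: (leq_trans leZ); rewrite [(w ^ k.+1)%N]expnS mulnCA leq_mul2l; apply/orP; right.
apply: IH => //.
  by rewrite lt0n; apply: contraTneq leZ => ->; rewrite muln0; lia.
rewrite expnS -mulnA in dom leH.
(* Halving the degree divides the bound by [2 ^ k * N], hence by at least N. *)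
have := hilb_domain_half dom fF nf.
move/leq_trans => /(_ _ (hilb_sub _ s1)) /leq_trans => /(_ _ leH).
set y := hilb (zeros _ _) _; rewrite expnS mulnCA mulnAC mulnC leq_pmul2l //.
by apply: leq_trans; rewrite leq_pmull // expn_gt0.
Qed.

End Bound.
End HilbertFunction.

(** * Polynomial functions *)

Section PolynomialFunctions.
Variables (K : fieldType) (d : nat).
Implicit Types (f g : 'rV[K]_d -> K) (m : nat).

Definition monomial (b : 'I_d -> nat) (y : 'rV[K]_d) := \prod_j y 0 j ^+ b j.

(* The degree bound is on each variable separately. *)
Definition polyfun m f := exists c : {ffun 'I_d -> 'I_m.+1} -> K,
  forall y, f y = \sum_b c b * monomial (fun j => b j) y.

Lemma polyfun_ext m f g : f =1 g -> polyfun m g -> polyfun m f.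
Proof. by move=> fg [c cE]; exists c => y; rewrite fg cE. Qed.

Lemma polyfun_monomial m (b : 'I_d -> nat) :
  (forall j, b j <= m)%N -> polyfun m (monomial b).
Proof.
move=> bm; pose b0 := [ffun j => inord (b j) : 'I_m.+1].
exists (fun b' => (b' == b0)%:R) => y.
rewrite (bigD1 b0) //= eqxx mul1r big1 ?addr0 => [|b' /negPf->]; last exact: mul0r.
by apply: eq_bigr => j _; rewrite ffunE inordK // ltnS.
Qed.

Lemma polyfunZ m a f : polyfun m f -> polyfun m (fun y => a * f y).
Proof.
move=> [c cE]; exists (fun b => a * c b) => y.
by rewrite cE mulr_sumr; apply: eq_bigr => b _; rewrite mulrA.
Qed.

Lemma polyfunD m f g : polyfun m f -> polyfun m g -> polyfun m (fun y => f y + g y).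
Proof.
move=> [c cE] [c' cE']; exists (fun b => c b + c' b) => y.
by rewrite cE cE' -big_split; apply: eq_bigr => b _; rewrite mulrDl.
Qed.

Lemma polyfun_const m a : polyfun m (fun=> a).
Proof.
have := @polyfun_monomial m (fun=> 0%N) (fun=> leq0n m) => /(polyfunZ a).
apply: polyfun_ext => y; rewrite /monomial big1 ?mulr1 // => j _; exact: expr0.
Qed.

Lemma polyfun_sum m (I : finType) (f : I -> 'rV[K]_d -> K) :
  (forall i, polyfun m (f i)) -> polyfun m (fun y => \sum_i f i y).
Proof.
move=> fP.
suff: forall s : seq I, polyfun m (fun y => \sum_(i <- s) f i y) by apply.
elim=> [|i s IH].
  by apply: polyfun_ext (polyfun_const m 0) => y; rewrite big_nil.
by apply: polyfun_ext (polyfunD (fP i) IH) => y; rewrite big_cons.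
Qed.

Lemma polyfunM m m' f g :
  polyfun m f -> polyfun m' g -> polyfun (m + m') (fun y => f y * g y).
Proof.
move=> [c cE] [c' cE'].
have /polyfun_sum : forall b : {ffun 'I_d -> 'I_m.+1}, polyfun (m + m')
    (fun y => \sum_b' (c b * c' b') * monomial (fun j => b j + b' j)%N y).
  move=> b; apply: polyfun_sum => b'; apply: polyfunZ; apply: polyfun_monomial => j.
  by rewrite leq_add // -ltnS.
apply: polyfun_ext => y; rewrite cE cE' mulr_suml; apply: eq_bigr => b _.
rewrite mulr_sumr; apply: eq_bigr => b' _; rewrite mulrACA; congr (_ * _).
by rewrite -big_split; apply: eq_bigr => j _; rewrite exprD.
Qed.

Lemma polyfun_leq m m' f : (m <= m')%N -> polyfun m f -> polyfun m' f.
Proof.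
move=> /subnKC <- fP; apply: polyfun_ext (polyfunM fP (polyfun_const _ 1)) => y.
by rewrite mulr1.
Qed.

Lemma polyfun_coord j : polyfun 1 (fun y => y 0 j).
Proof.
apply: polyfun_ext (polyfun_monomial (b := fun i => (i == j) : nat) _) => [y|i].
  by rewrite /monomial (bigD1 j) //= eqxx expr1 big1 ?mulr1 // => i /negPf->.
exact: leq_b1.
Qed.

Lemma polyfunB m f g : polyfun m f -> polyfun m g -> polyfun m (fun y => f y - g y).
Proof.
move=> fP /(polyfunZ (-1)) /(polyfunD fP); apply: polyfun_ext => y.
by rewrite mulN1r.
Qed.

Lemma polyfun_prod m k (f : 'I_k -> 'rV[K]_d -> K) :
  (forall i, polyfun m (f i)) -> polyfun (m * k) (fun y => \prod_i f i y).
Proof.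
elim: k f => [|k IH] f fP.
  by apply: polyfun_ext (polyfun_const _ 1) => y; rewrite big_ord0.
rewrite mulnS; apply: polyfun_ext (polyfunM (fP ord0) (IH _ (fun i => fP (lift ord0 i)))).
by move=> y; rewrite big_ord_recl.
Qed.

Lemma polyfun_det m k (A : 'rV[K]_d -> 'M[K]_k) :
  (forall i j, polyfun m (fun y => A y i j)) -> polyfun (m * k) (fun y => \det (A y)).
Proof.
move=> AP; apply: polyfun_sum => s; apply: polyfunZ; apply: polyfun_prod => i.
exact: AP.
Qed.

(** * Polynomial functions on a finite point set *)

Variables (n : nat) (pt : 'I_n -> 'rV[K]_d).

Definition values f : 'rV[K]_n := \row_i f (pt i).

Definition monomial_mx m : 'M[K]_(#|{ffun 'I_d -> 'I_m.+1}|, n) :=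
  \matrix_(b, i) monomial (fun j => (enum_val b : {ffun 'I_d -> 'I_m.+1}) j) (pt i).

Lemma monomial_mxP m u :
  reflect (exists2 f, polyfun m f & u = values f) (u <= monomial_mx m)%MS.
Proof.
apply: (iffP submxP) => [[c ->]|[f [c cE] ->]].
  exists (fun y => \sum_b c 0 (enum_rank b) * monomial (fun j => b j) y).
    by exists (fun b => c 0 (enum_rank b)).
  apply/rowP=> i; rewrite !mxE (reindex enum_rank) /=; last exact/onW_bij/enum_rank_bij.
  by apply: eq_bigr => b _; rewrite !mxE enum_rankK.
exists (\row_b c (enum_val b)); apply/rowP=> i; rewrite !mxE cE.
rewrite [RHS](reindex enum_rank) /=; last exact/onW_bij/enum_rank_bij.
by apply: eq_bigr => b _; rewrite !mxE enum_rankK.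
Qed.

Definition zero_set (Z : {set 'I_n}) f := [set i in Z | f (pt i) == 0].

Lemma zeros_values Z f : zeros Z (values f) = zero_set Z f.
Proof. by apply/setP=> i; rewrite !inE mxE. Qed.

(** There are (m+1)^d monomials with exponents at most m; for m = e 2^d N with N positive this is at
    most C N^d, where C is this constant. *)
Definition growth_const e := ((e * 2 ^ d.+1).+1 ^ d)%N.

Lemma card_bound_dimension e w : (0 < w)%N -> (0 < n)%N ->
    (forall Z : {set 'I_n}, (1 < #|Z|)%N -> exists f,
      [/\ polyfun e f, (exists2 i, i \in Z & f (pt i) != 0) &
          (#|Z| <= w * #|zero_set Z f|)%N]) ->
  (n <= (2 ^ (growth_const e * (growth_const e).+1 ^ d)) ^ d.+1 * w ^ d)%N.
Proof.
move=> w0 n0 popular; set C := growth_const e.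
rewrite -[X in (X <= _)%N]card_ord -cardsT.
apply: (@card_bound_growth _ _ _ monomial_mx _ _ e w C C.+1) => //.
- move=> m; apply/monomial_mxP; exists (fun=> 1); first exact: polyfun_const.
  by apply/rowP=> i; rewrite !mxE.
- move=> m m' u v /monomial_mxP[f fP ->] /monomial_mxP[g gP ->].
  apply/monomial_mxP; exists (fun y => f y * g y); first exact: polyfunM.
  by apply/rowP=> i; rewrite mul_mx_diag !mxE.
- move=> Z /popular[f [fP [i iZ fi] leZ]]; exists (values f); split.
  + by apply/monomial_mxP; exists f.
  + by apply/forall_inP => /(_ i iZ); rewrite mxE (negPf fi).
  + by rewrite zeros_values.
- by rewrite cardsT card_ord.
rewrite (leq_trans (mxrankM_maxl _ _)) // (leq_trans (rank_leq_row _)) //.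
rewrite card_ffun !card_ord -expnMn.
have le_base : ((e * (2 ^ d * C.+1)).+1 <= (e * 2 ^ d.+1).+1 * C.+1)%N.
  rewrite expnS; nia.
by have [->|d0] := posnP d; rewrite ?expn0 // leq_exp2r.
Qed.

End PolynomialFunctions.

(** * Squared volumes *)

Section SquaredVolume.
Variables (K : realFieldType) (d : nat).

Local Notation ones k := (const_mx 1 : 'cV[K]_k).

(** Left multiplication turns a list of vertices into the edges at vertex 0. *)
Definition diff_mx k : 'M[K]_(k, 1 + k) := row_mx (- ones k) 1%:M.
Definition tail_mx k : 'M[K]_(1 + k, k) := col_mx 0 1%:M.
(** Gram determinant of the edges, (k!)^2 times the squared volume: a polynomial in the vertices,
    unlike the volume. *)
Definition vol2 k (P : 'M[K]_(1 + k, d)) : K :=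
  \det (diff_mx k *m P *m (diff_mx k *m P)^T).

Lemma ones1 : ones 1 = 1%:M.
Proof. by apply/matrixP=> i j; rewrite !mxE !ord1 eqxx. Qed.

Lemma ones_col k k' : ones (k + k') = col_mx (ones k) (ones k').
Proof. by rewrite col_mx_const. Qed.

Lemma diff_tail k : diff_mx k *m tail_mx k = 1%:M.
Proof. by rewrite mul_row_col mulmx0 add0r mul1mx. Qed.

Lemma diff_ones k : diff_mx k *m ones (1 + k) = 0.
Proof. by rewrite ones_col mul_row_col ones1 mul1mx mulmx1 addNr. Qed.

Lemma tail_diff k : tail_mx k *m diff_mx k = 1%:M - ones (1 + k) *m row_mx 1%:M 0.
Proof.
rewrite (scalar_mx_block 1 k) ones_col ones1.
rewrite mul_col_row mul_col_row opp_block_mx add_block_mx.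
by rewrite !mul0mx !mul1mx !mulmx0 ?mulmx1 subrr oppr0 addr0 add0r subr0.
Qed.

(** A matrix with row sums 1 acts on edges through its linear part [diff_mx k *m Q *m tail_mx k]. *)
Lemma diff_affine k (Q : 'M_(1 + k)) : Q *m ones (1 + k) = ones (1 + k) ->
  diff_mx k *m Q *m tail_mx k *m diff_mx k = diff_mx k *m Q.
Proof.
move=> Q1; rewrite -mulmxA tail_diff mulmxBr mulmx1 !mulmxA.
by rewrite -(mulmxA _ Q) Q1 diff_ones mul0mx subr0.
Qed.

(** The determinant 1 matrices T and S bring Q to block triangular form, with diagonal blocks 1 and
    the linear part. *)
Lemma det_affine k (Q : 'M_(1 + k)) : Q *m ones (1 + k) = ones (1 + k) ->
  \det (diff_mx k *m Q *m tail_mx k) = \det Q.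
Proof.
move=> Q1; pose e0 : 'M[K]_(1, 1 + k) := row_mx 1%:M 0.
pose T := col_mx e0 (diff_mx k); pose S := row_mx (ones (1 + k)) (tail_mx k).
have detT : \det T = 1 by rewrite /T /e0 det_lblock !det1 mulr1.
have detS : \det S = 1.
  by rewrite /S ones_col ones1 /tail_mx -block_mxEh det_lblock !det1 mulr1.
have <- : \det (T *m Q *m S) = \det Q by rewrite !det_mulmx detT detS mul1r mulr1.
rewrite /T /S mul_col_mx mul_col_row -!mulmxA Q1 diff_ones det_ublock.
have -> : e0 *m ones (1 + k) = 1%:M by rewrite ones_col mul_row_col mul1mx mul0mx addr0 ones1.
by rewrite det1 mul1r.
Qed.

Lemma vol2_affine k (Q : 'M_(1 + k)) P : Q *m ones (1 + k) = ones (1 + k) ->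
  vol2 (Q *m P) = \det Q ^+ 2 * vol2 P.
Proof.
move=> Q1; rewrite /vol2 mulmxA -(diff_affine Q1) -(det_affine Q1).
set M := diff_mx k *m Q *m _; rewrite -(mulmxA M); set E := diff_mx k *m P.
have -> : M *m E *m (M *m E)^T = M *m (E *m E^T) *m M^T by rewrite trmx_mul !mulmxA.
by rewrite !det_mulmx det_tr; ring.
Qed.

Lemma vol2_perm k (s : {perm 'I_(1 + k)}) P : vol2 (row_perm s P) = vol2 P.
Proof.
rewrite row_permE vol2_affine; first by rewrite det_perm sqrr_sign mul1r.
by rewrite -row_permE; apply/matrixP=> i j; rewrite !mxE.
Qed.

(** A null vector v of the Gram matrix gives a vanishing sum of squares, hence a linear relation
    between edges; [v *m diff_mx k] is the affine relation between vertices. *)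
Lemma vol2_eq0P k (P : 'M_(1 + k, d)) :
  reflect (exists w : 'rV_(1 + k), [/\ w != 0, w *m ones (1 + k) = 0 & w *m P = 0])
          (vol2 P == 0).
Proof.
apply: (iffP det0P) => [[v v0 vG]|[w [w0 w1 wP]]].
  exists (v *m diff_mx k); split.
  - apply: contraNneq v0 => vD; rewrite -[v]mulmx1 -diff_tail mulmxA vD.
    by rewrite mul0mx.
  - by rewrite -mulmxA diff_ones mulmx0.
  rewrite -mulmxA; set u := v *m _; have : u *m u^T = 0.
    by rewrite /u trmx_mul mulmxA -(mulmxA v) vG mul0mx.
  move: u => u /matrixP/(_ 0 0); rewrite !mxE => /eqP.
  under eq_bigr do rewrite !mxE -expr2.
  rewrite psumr_eq0 => [/allP u0|i _]; last exact: sqr_ge0.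
  apply/rowP=> i; have := u0 i (mem_index_enum i).
  by rewrite /= sqrf_eq0 => /eqP->; rewrite mxE.
have wE : w *m tail_mx k *m diff_mx k = w.
  by rewrite -mulmxA tail_diff mulmxBr mulmx1 mulmxA w1 mul0mx subr0.
exists (w *m tail_mx k).
  by apply: contraNneq w0 => wT; rewrite -wE wT mul0mx.
by rewrite mulmxA mulmxA wE wP mul0mx.
Qed.

Lemma vol2_repeat k (P : 'M_(1 + k, d)) i j :
  i != j -> row i P = row j P -> vol2 P = 0.
Proof.
move=> nij Pij; apply/eqP/vol2_eq0P; exists (delta_mx 0 i - delta_mx 0 j); split.
- apply/eqP=> /rowP/(_ i); rewrite !mxE !eqxx (negPf nij) /= subr0.
  by apply/eqP/oner_neq0.
- by rewrite mulmxBl -!rowE; apply/matrixP=> a b; rewrite !mxE subrr.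
- by rewrite mulmxBl -!rowE Pij subrr.
Qed.

Lemma vol2_cone_neq0 k x (B : 'M_(1 + k, d)) :
  vol2 (col_mx x B) != 0 -> vol2 B != 0.
Proof.
apply: contraNneq => /eqP/vol2_eq0P[w [w0 w1 wB]]; apply/vol2_eq0P.
exists (row_mx 0 w); split.
- by apply: contraNneq w0 => /(congr1 rsubmx); rewrite row_mxKr linear0 => ->.
- by rewrite ones_col mul_row_col mul0mx add0r.
- by rewrite mul_row_col mul0mx add0r.
Qed.

(** The affine relation involves x, since the points of B satisfy none; solve it for x. *)
Lemma affine_span k x (B : 'M_(1 + k, d)) :
    vol2 B != 0 -> vol2 (col_mx x B) = 0 ->
  exists q : 'rV_(1 + k), q *m ones (1 + k) = 1%:M /\ x = q *m B.
Proof.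
move=> B0 /eqP/vol2_eq0P[w]; rewrite -[w]hsubmxK ones_col !mul_row_col ones1 mulmx1.
set a := lsubmx w; set v := rsubmx w; rewrite [a]mx11_scalar mul_scalar_mx.
move: (a 0 0) => {a}a; move: v => v [w0 w1 wB].
have [a0|a0] := eqVneq a 0.
  case/eqP: B0; apply/eqP/vol2_eq0P; exists v; split.
  - by apply: contraNneq w0 => v0; rewrite a0 v0 raddf0 row_mx0.
  - by move: w1; rewrite a0 raddf0 add0r.
  - by move: wB; rewrite a0 scale0r add0r.
exists (- a^-1 *: v); split.
  rewrite -scalemxAl; move/eqP: w1; rewrite addrC addr_eq0 => /eqP->.
  by rewrite scalerN scaleNr opprK scale_scalar_mx mulVf.
rewrite -scalemxAl; move/eqP: wB; rewrite addrC addr_eq0 => /eqP->.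
by rewrite scalerN scaleNr opprK scalerA mulVf // scale1r.
Qed.

(* When the vertices of A lie in the affine hull of B, A = Q B with Q affine,
   and coning with x changes both squared volumes by the factor (det Q)^2. *)
Lemma vol2_same_hull k x (A B : 'M_(1 + k, d)) :
    vol2 (col_mx x A) = vol2 (col_mx x B) -> vol2 (col_mx x B) != 0 ->
    (forall i, vol2 (col_mx (row i A) B) = 0) ->
  vol2 A = vol2 B /\ (k = 0%N -> A = B).
Proof.
move=> eqAB xB0 AB0; have B0 := vol2_cone_neq0 xB0.
have /choice[q qP] := fun i => affine_span B0 (AB0 i).
pose Q := \matrix_i q i.
have Q1 : Q *m ones (1 + k) = ones (1 + k).
  apply/row_matrixP=> i; rewrite row_mul rowK (qP i).1.
  by apply/matrixP=> a b; rewrite !mxE !ord1.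
have AQ : A = Q *m B by apply/row_matrixP=> i; rewrite row_mul rowK (qP i).2.
(* For k = 0 the squared volume is always 1 and carries no information, but then Q is a 1 by 1
   matrix with row sum 1. *)
split; last first.
  move=> k0; rewrite AQ; suff -> : Q = 1%:M by rewrite mul1mx.
  clear -Q1 k0; subst k; move: Q1.
  have -> : ones (1 + 0) = 1%:M by exact: ones1.
  by rewrite mulmx1.
have Q'1 : block_mx (1%:M : 'M_1) 0 0 Q *m ones (1 + (1 + k)) = ones (1 + (1 + k)).
  by rewrite ones_col mul_block_col !mul0mx Q1 mul1mx addr0 add0r.
have xA : col_mx x A = block_mx (1%:M : 'M_1) 0 0 Q *m col_mx x B.
  by rewrite mul_block_col !mul0mx mul1mx addr0 add0r AQ.
move: eqAB; rewrite xA vol2_affine // det_ublock det1 mul1r -[RHS]mul1r.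
move/(mulIf xB0); rewrite AQ vol2_affine // => ->.
by rewrite mul1r.
Qed.

(** With y as vertex 0 every edge is a row of B minus y, so the Gram entries are quadratic in y. *)
Lemma polyfun_vol2 k (B : 'M_(k, d)) :
  polyfun (2 * k) (fun y => vol2 (col_mx y B)).
Proof.
apply: polyfun_det => i j.
apply: (@polyfun_ext _ _ _ _
  (fun y : 'rV_d => \sum_l ((B i l - y 0 l) * (B j l - y 0 l)))).
  move=> y; rewrite mxE; apply: eq_bigr => l _; rewrite mul_row_col mulNmx mul1mx.
  by rewrite !mxE !big_ord1 !mxE !mul1r; ring.
apply: polyfun_sum => l; rewrite -[2%N]/(1 + 1)%N; apply: polyfunM;
  by apply: polyfunB; [apply: polyfun_const | apply: polyfun_coord].
Qed.

End SquaredVolume.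

(** * Sets with distinct volumes *)

(** Pigeonhole: the sets [W c] over good c in C cover Z; take the largest. *)
Lemma popular_fiber (I J : finType) (Z : {set J}) (C : {set I}) (good : I -> Prop)
    (W : I -> {set J}) :
    (0 < #|Z|)%N ->
    (forall x, x \in Z -> exists c, [/\ c \in C, good c & x \in W c]) ->
  exists c, good c /\ (#|Z| <= #|C| * #|W c|)%N.
Proof.
move=> Z0 cover; pose C' := [set c in C | `[< good c >]].
have [c0 c0C'] : exists c0, c0 \in C'.
  case/card_gt0P: Z0 => x /cover[c [cC gc _]]; exists c.
  by rewrite inE cC; apply/asboolP.
have [c cC' cmax] := @arg_maxnP _ c0 (mem C') (fun c => #|W c|) c0C'.
have {}cC' : c \in C' := cC'.
exists c; split; first by move: cC'; rewrite inE => /andP[_ /asboolP].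
have C'C : (#|C'| <= #|C|)%N by apply: subset_leq_card; apply/subsetP=> b; rewrite inE => /andP[].
apply: leq_trans (leq_mul C'C (leqnn _)); rewrite -sum_nat_const.
apply: (@leq_trans (\sum_(b in C') \sum_(x in Z) (x \in W b))); last first.
  apply: leq_sum => b bC'; apply: leq_trans (cmax b bC').
  rewrite -sum1_card big_mkcond [X in (_ <= X)%N]big_mkcond.
  by apply: leq_sum => x _; case: (x \in Z); case: (x \in W b).
rewrite exchange_big /= -sum1_card; apply: leq_sum => x /cover[b [bC gb xb]].
rewrite (bigD1 b) /=; last by rewrite inE bC; apply/asboolP.
by rewrite xb.
Qed.

Section DistinctVolumes.
Variables (K : realFieldType) (n d : nat) (pt : 'I_n -> 'rV[K]_d).
Hypothesis pt_inj : injective pt.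
Implicit Types (M Z : {set 'I_n}).

Definition pts k (p : 'I_k -> 'I_n) : 'M[K]_(k, d) := \matrix_i pt (p i).

(** Ordered tuples are compared by their vertex sets; a tuple of nonzero volume is injective, so its
    vertex set has k + 1 points. *)
Definition distinct_simplices k M := forall p q : 'I_(1 + k) -> 'I_n,
  (forall i, p i \in M) -> (forall i, q i \in M) ->
  vol2 (pts p) != 0 -> vol2 (pts p) = vol2 (pts q) ->
  [set p i | i in 'I_(1 + k)] = [set q i | i in 'I_(1 + k)].

(* Here k is the dimension of the simplices, which have k + 1 vertices. All sizes
   up to a are needed, not only a: two (k+1)-sets with the same affine hull and
   the same volume form (k+2)-sets of equal volumes with any x. *)
Definition rainbow a M := forall k, (0 < k < a)%N -> distinct_simplices k M.

Lemma rainbowS a M M' : M' \subset M -> rainbow a M -> rainbow a M'.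
Proof.
move=> /subsetP sM rM k ka p q pM qM.
by apply: (rM k ka) => i; apply: sM.
Qed.

Lemma pts_inj k (p : 'I_(1 + k) -> 'I_n) i j : vol2 (pts p) != 0 -> p i = p j -> i = j.
Proof.
move=> p0 pij; apply/eqP; apply: contraNT p0 => nij; apply/eqP.
by apply: (vol2_repeat nij); rewrite !rowK pij.
Qed.

Lemma vol2_vertex k (p : 'I_(1 + k) -> 'I_n) i : vol2 (col_mx (pt (p i)) (pts p)) = 0.
Proof.
apply: (@vol2_repeat _ _ _ _ (lshift _ 0) (rshift 1 i)); first by rewrite eq_lrshift.
by rewrite rowKu rowKd rowK; apply/rowP=> j; rewrite !mxE.
Qed.

Lemma vol2_point x y : x != y -> vol2 (col_mx (pt x) (pts (fun _ : 'I_(1 + 0) => y))) != 0.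
Proof.
apply: contraNneq => /affine_span[]; first by rewrite /vol2 det_mx00 oner_neq0.
move=> q [q1 xq]; apply/eqP/pt_inj; rewrite xq.
have := q1; have -> : const_mx 1 = 1%:M :> 'M[K]_(1 + 0).
  by apply/matrixP=> i j; rewrite !mxE !ord1 eqxx.
rewrite mulmx1 => ->; apply/rowP=> j.
by rewrite !mxE big_ord1 !mxE mul1r.
Qed.

(** Moving x to position 0 exhibits the simplex as a cone over A; p is injective, so the remaining
    vertices differ from x. *)
Lemma vol2_apex k x M (p : 'I_(1 + k.+1) -> 'I_n) : (forall i, p i \in x |: M) ->
    vol2 (pts p) != 0 -> x \in [set p i | i in 'I_(1 + k.+1)] ->
  exists A : 'I_(1 + k) -> 'I_n, [/\ forall i, A i \in M,
    vol2 (pts p) = vol2 (col_mx (pt x) (pts A)) &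
    [set p i | i in 'I_(1 + k.+1)] = x |: [set A i | i in 'I_(1 + k)]].
Proof.
move=> pM p0 /imsetP[i0 _ xp]; pose s := tperm ord0 i0.
pose A j := p (s (rshift 1 j)).
have s0 : s (lshift k.+1 (0 : 'I_1)) = i0 by rewrite -(tpermL ord0 i0); congr (s _); apply/val_inj.
exists A; split.
- move=> j; have := pM (s (rshift 1 j)); rewrite in_setU1 => /predU1P[eqx|//].
  have /perm_inj : s (rshift 1 j) = s (lshift k.+1 (0 : 'I_1)).
    by rewrite s0; apply: (pts_inj p0); rewrite -xp.
  by move/(congr1 val).
- rewrite -(vol2_perm s (pts p)); congr vol2.
  rewrite -[LHS]vsubmxK; congr col_mx; apply/matrixP=> i j; rewrite !mxE //.
  by rewrite !ord1 s0 -xp.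
apply/setP=> y; rewrite in_setU1; apply/imsetP/predU1P => [[i _ ->]|[->|/imsetP[j _ ->]]].
- rewrite -(tpermK ord0 i0 i) -/s; case: (@split_ordP 1 k.+1 (s i)) => j ->.
    by left; rewrite ord1 s0.
  by right; apply: imset_f.
- by exists i0.
- by exists (s (rshift 1 j)).
Qed.


Lemma pack_points k1 k2 m M (A : 'I_k1.+1 -> 'I_n) (B : 'I_k2.+1 -> 'I_n) :
    (k1 + k2 < m)%N -> (forall i, A i \in M) -> (forall i, B i \in M) ->
  exists r : {ffun 'I_m.+1 -> 'I_n}, [/\ r \in ffun_on (mem M),
    forall i : 'I_k1.+1, r (inord i) = A i &
    forall i : 'I_k2.+1, r (inord (k1.+1 + i)) = B i].
Proof.
(* Beyond the points of B, [inord] falls back on index 0, so the padding stays in M. *)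
move=> lem AM BM; exists [ffun j : 'I_m.+1 =>
  if (j < k1.+1)%N then A (inord j) else B (inord (j - k1.+1))]; split.
- by apply/ffun_onP=> j; rewrite ffunE; case: ifP => _; [apply: AM | apply: BM].
- move=> i; have lti := ltn_ord i; rewrite ffunE inordK; last by lia.
  by rewrite lti inord_val.
move=> i; have lti := ltn_ord i; rewrite ffunE inordK; last by lia.
by rewrite ltnNge leq_addr /= addKn inord_val.
Qed.

(** * Equations satisfied by the points of Z *)

Variable a : nat.
Hypothesis a_gt1 : (1 < a)%N.

(** The longest equation that arises has k + 1 points in A and k + 2 in Q, with k + 2 at most a: at
    most 2a - 1 in all, the source of the exponent. *)
Definition collision := ('I_a * 'I_3 * {ffun 'I_(2 * a - 2).+1 -> 'I_n})%type.

(* The pair (k, s) selects the shape of the equation; r lists the k + 1 points of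
   A followed by those of B or Q, and is arbitrary beyond them. *)
Definition collision_fun (c : collision) (y : 'rV[K]_d) : K :=
  let: (k, s, r) := c in
  let A := pts (fun i : 'I_(1 + k) => r (inord i)) in
  let B := pts (fun i : 'I_(1 + k) => r (inord (k.+1 + i))) in
  let Q := pts (fun i : 'I_(1 + k.+1) => r (inord (k.+1 + i))) in
  vol2 (col_mx y A) -
  match val s with 0%N => 0 | 1%N => vol2 (col_mx y B) | _ => vol2 Q end.

Lemma polyfun_collision c : polyfun (2 * a) (collision_fun c).
Proof.
case: c => [[k s] r].
have poly B : polyfun (2 * a) (fun y : 'rV[K]_d => vol2 (col_mx y (B : 'M_(1 + k, d)))).
  by apply: polyfun_leq (polyfun_vol2 B); rewrite leq_mul2l; apply: ltn_ord.
apply: polyfunB; first exact: poly.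
by case: (val s) => [|[|i]]; first [apply: poly | apply: polyfun_const].
Qed.

Definition nonvanishing Z (f : 'rV[K]_d -> K) := exists2 z, z \in Z & f (pt z) != 0.

(** Shape 0 with k = 0 says that y is at distance 0 from x, which fails at any other point of Z. *)
Lemma collision_member Z M x : (1 < #|Z|)%N -> x \in Z -> x \in M ->
  exists c : collision, [/\ c.2 \in ffun_on (mem M), nonvanishing Z (collision_fun c) &
    collision_fun c (pt x) = 0].
Proof.
move=> Z1 xZ xM.
have [z zZ zx] : exists2 z, z \in Z & z != x.
  have : (0 < #|Z :\ x|)%N by have := cardsD1 x Z; rewrite xZ; lia.
  by case/card_gt0P=> z; rewrite !inE => /andP[zx zZ]; exists z.
have a0 : (0 < a)%N by lia.
exists (Ordinal a0, ord0, [ffun=> x]); split.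
- by apply/ffun_onP=> i; rewrite ffunE.
- exists z => //; rewrite /collision_fun /= subr0.
  rewrite (_ : pts _ = pts (fun=> x)); first exact: vol2_point.
  by apply/row_matrixP=> i; rewrite !rowK ffunE.
rewrite /collision_fun /= subr0 (_ : pts _ = pts (fun=> x)).
  exact: (@vol2_vertex 0 (fun=> x) 0).
by apply/row_matrixP=> i; rewrite !rowK ffunE.
Qed.

Lemma collision_new Z M x k (p q : 'I_(1 + k.+1) -> 'I_n) :
    (k.+1 < a)%N -> M \subset Z -> rainbow a M ->
    (forall i, p i \in x |: M) -> (forall i, q i \in x |: M) ->
    vol2 (pts p) != 0 -> vol2 (pts p) = vol2 (pts q) ->
    [set p i | i in 'I_(1 + k.+1)] != [set q i | i in 'I_(1 + k.+1)] ->
    x \in [set p i | i in 'I_(1 + k.+1)] ->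
  exists c : collision, [/\ c.2 \in ffun_on (mem M), nonvanishing Z (collision_fun c) &
    collision_fun c (pt x) = 0].
Proof.
move=> ka /subsetP sM rM pM qM p0 pq npq xp.
have ka' : (k < a)%N by lia.
have [A [AM pA imA]] := vol2_apex pM p0 xp.
have q0 : vol2 (pts q) != 0 by rewrite -pq.
have [xq|xq] := boolP (x \in [set q i | i in 'I_(1 + k.+1)]).
  have [B [BM qB imB]] := vol2_apex qM q0 xq.
  have lek : (k + k < 2 * a - 2)%N by lia.
  have [r [rM' rA rB]] := pack_points lek AM BM.
  have cE y : collision_fun (Ordinal ka', @Ordinal 3 1 isT, r) y =
      vol2 (col_mx y (pts A)) - vol2 (col_mx y (pts B)).
    have eA : pts (fun i : 'I_(1 + k) => r (inord i)) = pts A.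
      by apply/row_matrixP=> i; rewrite !rowK rA.
    have eB : pts (fun i : 'I_(1 + k) => r (inord (k.+1 + i))) = pts B.
      by apply/row_matrixP=> i; rewrite !rowK rB.
    by rewrite /collision_fun /= eA eB.
  exists (Ordinal ka', @Ordinal 3 1 isT, r); split=> //; last by rewrite cE -pA -qB pq subrr.
  (* If the equation held on Z, its values at the vertices of A would put A in the hull of B; then A
     and B have equal volumes, hence equal vertex sets, by [rM] in dimension k or directly for k =
     0. *)
  apply: contrapT => van.
  have {}van z : z \in Z -> vol2 (col_mx (pt z) (pts A)) = vol2 (col_mx (pt z) (pts B)).
    move=> zZ; apply/eqP; rewrite -subr_eq0; apply/negPn/negP => nz; apply: van.
    by exists z; rewrite ?cE.
  have [volAB AB] : vol2 (pts A) = vol2 (pts B) /\ (k = 0%N -> pts A = pts B).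
    apply: (@vol2_same_hull _ _ _ (pt x)) => [||i]; rewrite -?pA -?qB //.
    by rewrite rowK -(van _ (sM _ (AM i))) vol2_vertex.
  case/eqP: npq; rewrite imA imB; congr (x |: _).
  have [k0|k0] := posnP k.
    apply: eq_imset => i; apply: pt_inj.
    by have := AB k0 => /(congr1 (row i)); rewrite !rowK.
  apply: (rM k) => //; first by rewrite k0.
  by apply: (@vol2_cone_neq0 _ _ _ (pt x)); rewrite -pA.
have qM' i : q i \in M.
  by have := qM i; rewrite in_setU1 => /predU1P[qi|//]; case/imsetP: xq; exists i.
have lek : (k + k.+1 < 2 * a - 2)%N by lia.
have [r [rM' rA rB]] := pack_points lek AM qM'.
have cE y : collision_fun (Ordinal ka', @Ordinal 3 2 isT, r) y = vol2 (col_mx y (pts A)) - vol2 (pts q).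
  have eA : pts (fun i : 'I_(1 + k) => r (inord i)) = pts A.
    by apply/row_matrixP=> i; rewrite !rowK rA.
  have eQ : pts (fun i : 'I_(1 + k.+1) => r (inord (k.+1 + i))) = pts q.
    by apply/row_matrixP=> i; rewrite !rowK rB.
  by rewrite /collision_fun /= eA eQ.
exists (Ordinal ka', @Ordinal 3 2 isT, r); split=> //; last by rewrite cE -pA pq subrr.
(* At a vertex of A the cone degenerates, while the volume of q is nonzero. *)
by exists (A ord0); rewrite ?sM // cE vol2_vertex sub0r oppr_eq0.
Qed.

(** Take a maximal rainbow M inside Z: each point of Z solves an equation with data in M, and there
    are at most [a * 3 * t ^ (2 * a - 1)] of these. *)
Lemma collision_popular t Z : (0 < t)%N -> (1 < #|Z|)%N ->
    (forall M, rainbow a M -> #|M| <= t)%N ->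
  exists f, [/\ polyfun (2 * a) f, nonvanishing Z f &
    (#|Z| <= a * 3 * t ^ (2 * a - 1) * #|zero_set pt Z f|)%N].
Proof.
move=> t0 Z1 small.
pose P M := (M \subset Z) && `[< rainbow a M >].
have P0 : P set0.
  rewrite /P sub0set; apply/asboolP=> k _ p q /(_ ord0).
  by rewrite inE.
have [M /maxsetP[/andP[sM /asboolP rM] Mmax] _] := maxset_exists P0.
have cover x : x \in Z -> exists c : collision,
    [/\ c \in [set c | c.2 \in ffun_on (mem M)],
        nonvanishing Z (collision_fun c) & x \in zero_set pt Z (collision_fun c)].
  move=> xZ; suff [c [cM cZ cx]] : exists c : collision, [/\ c.2 \in ffun_on (mem M),
      nonvanishing Z (collision_fun c) & collision_fun c (pt x) = 0].
    by exists c; split=> //; rewrite in_set // xZ cx eqxx.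
  have [xM|xM] := boolP (x \in M); first exact: collision_member.
  have /existsNP[k /not_implyP[ka /existsNP[p /existsNP[q]]]] : ~ rainbow a (x |: M).
    move=> rxM; case/negP: xM; rewrite -(Mmax (x |: M)) ?setU11 ?subsetUr //.
    by rewrite /P subUset sub1set xZ sM; apply/asboolP.
  move=> /not_implyP[pM /not_implyP[qM /not_implyP[p0 /not_implyP[pq npq]]]].
  case: k ka p q pM qM p0 pq npq => // k ka p q pM qM p0 pq /eqP npq.
  have [xp|xp] := boolP (x \in [set p i | i in 'I_(1 + k.+1)]).
    exact: collision_new npq xp.
  have [xq|xq] := boolP (x \in [set q i | i in 'I_(1 + k.+1)]).
    by apply: collision_new xq => //; rewrite -?pq // eq_sym.
  (* If x is a vertex of neither simplex, both lie in M, which is rainbow. *)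
  case/eqP: npq; apply: (rM k.+1) => //.
    by move=> i; have := pM i; rewrite in_setU1 => /predU1P[pi|//]; case/imsetP: xp; exists i.
  by move=> i; have := qM i; rewrite in_setU1 => /predU1P[qi|//]; case/imsetP: xq; exists i.
have Z0 : (0 < #|Z|)%N by lia.
have [c [cZ leZ]] := popular_fiber Z0 cover.
exists (collision_fun c); split=> //; first exact: polyfun_collision.
apply: leq_trans leZ _; rewrite leq_mul2r; apply/orP; right.
have -> : [set c : collision | c.2 \in ffun_on (mem M)] =
    setX [set: 'I_a * 'I_3] [set r in ffun_on (mem M)].
  by apply/setP=> -[u r]; rewrite in_setX !in_set.
rewrite cardsX cardsT card_prod !card_ord cardsE card_ffun_on card_ord.
have -> : (2 * a - 2).+1 = (2 * a - 1)%N by lia.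
by rewrite leq_mul2l leq_exp2r ?small ?orbT //; lia.
Qed.

End DistinctVolumes.

(** * The function h *)

(** What [card_bound_dimension] gives for degree 2a and w = 3a t^(2a-1), with the power of t split
    off. *)
Definition rainbow_const a d :=
  ((2 ^ (growth_const d (2 * a) * (growth_const d (2 * a)).+1 ^ d)) ^ d.+1 *
    (a * 3) ^ d)%N.

Lemma card_bound_rainbow (K : realFieldType) n d (pt : 'I_n -> 'rV[K]_d) a t :
    injective pt -> (1 < a)%N -> (0 < t)%N -> (0 < n)%N ->
    (forall M, rainbow pt a M -> #|M| <= t)%N ->
  (n <= rainbow_const a d * t ^ ((2 * a - 1) * d))%N.
Proof.
move=> pt_inj a1 t0 n0 small.
rewrite /rainbow_const -mulnA (expnM t) -expnMn.
apply: (card_bound_dimension (pt := pt)) => //.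
  by rewrite muln_gt0 expn_gt0 t0 muln_gt0; lia.
by move=> Z Z1; exact: collision_popular.
Qed.

Lemma rainbow1 (K : realFieldType) n d (pt : 'I_n -> 'rV[K]_d) a x :
  rainbow pt a [set x].
Proof.
move=> k _ p q pM qM _ _; apply: eq_imset => i.
by have := pM i; have := qM i; rewrite !inE => /eqP-> /eqP->.
Qed.

Lemma subset_card (T : finType) (M : {set T}) k : (k <= #|M|)%N ->
  exists2 M' : {set T}, M' \subset M & #|M'| = k.
Proof.
move=> kM; exists [set x in take k (enum M)].
  by apply/subsetP=> x; rewrite inE => /mem_take; rewrite mem_enum.
have /card_uniqP u : uniq (take k (enum M)) by rewrite take_uniq ?enum_uniq.
by rewrite cardsE u size_takel // -cardE.
Qed.

Section Volume.
Variables (R : realType) (d : nat).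

Lemma simplex_volumeE n (pt : 'I_n -> 'rV[R]_d) k (p : 'I_k.+1 -> 'I_n) P :
  (forall i, P i = pt (p i)) ->
  simplex_volume P = Num.sqrt (vol2 (pts pt (p : 'I_(1 + k) -> _))) / k`!%:R.
Proof.
move=> PE; rewrite /simplex_volume /vol2.
have -> // : edge_mx P = diff_mx R k *m pts pt (p : 'I_(1 + k) -> _).
apply/matrixP=> i j; rewrite -[pts _ _]vsubmxK mul_row_col mulNmx mul1mx.
rewrite !mxE big_ord1 !mxE mul1r !PE addrC.
by congr (pt (p _) 0 j - pt (p _) 0 j); apply/val_inj.
Qed.

Lemma volumeE (A : {fset 'rV[R]_d}) k : #|` A|%fset = k.+1 ->
  volume A = simplex_volume (fun i : 'I_k.+1 => (enum_fset A)`_i).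
Proof. by rewrite /volume => ->. Qed.

Lemma rainbow_distinct_volumes n (pt : 'I_n -> 'rV[R]_d) a M :
  injective pt -> (1 < a)%N -> rainbow pt a M ->
  distinct_volumes a [fset pt i | i in M]%fset.
Proof.
move=> pt_inj a1 rM A B /fsubsetP AT /fsubsetP BT cA cB.
case: a a1 rM cA cB => // k k0 rM cA cB.
have points (D : {fset 'rV[R]_d}) : {subset D <= [fset pt i | i in M]%fset} ->
    #|` D|%fset = k.+1 -> exists p : 'I_k.+1 -> 'I_n,
      (forall i, p i \in M) /\ forall i : 'I_k.+1, (enum_fset D)`_i = pt (p i).
  move=> DT cD; have /choice[p pP] : forall i : 'I_k.+1, exists j,
      j \in M /\ (enum_fset D)`_i = pt j.
    move=> i; have : (enum_fset D)`_i \in D by rewrite mem_nth // cD.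
    by move=> /DT/imfsetP[j jM ->]; exists j.
  by exists p; split=> i; have [] := pP i.
have [p [pM pA]] := points A AT cA; have [q [qM qB]] := points B BT cB.
rewrite (volumeE cA) (volumeE cB) (simplex_volumeE pA) (simplex_volumeE qB).
set u := vol2 _; set v := vol2 _.
have fk : k`!%:R^-1 != 0 :> R by rewrite invr_eq0 pnatr_eq0 -lt0n fact_gt0.
(* Nonzero volumes mean positive [vol2], where the square root is injective. *)
rewrite !mulf_eq0 !negb_or fk !andbT !sqrtr_eq0 -!ltNge => u0 v0.
apply: contra_neq => /(mulIf fk) /eqP; rewrite eqr_sqrt ?ltW // => /eqP uv.
have imE : [set p i | i in 'I_(1 + k)] = [set q i | i in 'I_(1 + k)].
  by apply: (rM k) => //; [rewrite -ltnS k0 ltnSn | apply: lt0r_neq0].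
have mem_points (D : {fset 'rV[R]_d}) (r : 'I_k.+1 -> 'I_n) y : #|` D|%fset = k.+1 ->
    (forall i : 'I_k.+1, (enum_fset D)`_i = pt (r i)) ->
    (y \in D) = [exists i, y == pt (r i)].
  move=> cD rD; apply/idP/existsP => [yD|[i /eqP->]]; last by rewrite -rD mem_nth // cD.
  have iD : (index y (enum_fset D) < k.+1)%N by rewrite -cD index_mem.
  by exists (Ordinal iD); rewrite -rD nth_index.
apply/fsetP=> y; rewrite (mem_points A p) // (mem_points B q) //.
apply/existsP/existsP => [] [i /eqP->].
  have /imsetP[j _ ->] : p i \in [set q i | i in 'I_(1 + k)] by rewrite -imE imset_f.
  by exists j.
have /imsetP[j _ ->] : q i \in [set p i | i in 'I_(1 + k)] by rewrite imE imset_f.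
by exists j.
Qed.

Lemma h_bound a n : (1 < a)%N -> (0 < n)%N -> (0 < d)%N ->
  (n <= rainbow_const a d * h R a d n ^ ((2 * a - 1) * d))%N.
Proof.
move=> a1 n0 d0.
have q0 : (0 < (2 * a - 1) * d)%N by rewrite muln_gt0 d0 andbT; lia.
have hn : (h R a d n <= n)%N by apply/bigmax_leqP => t _; rewrite -ltnS.
(* When h = n, the value h + 1 is outside the range of the maximum; otherwise it is avoided by some
   S, to which the cardinality bound applies. *)
have [nh|] := leqP n (h R a d n).
  have -> : h R a d n = n by apply/eqP; rewrite eqn_leq hn.
  apply: (@leq_trans (n ^ ((2 * a - 1) * d))%N).
    by rewrite -{1}[n]expn1 leq_pexp2l.
  by rewrite leq_pmull // !muln_gt0 !expn_gt0; lia.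
move: (erefl (h R a d n)); rewrite {1}/h; move: (h R a d n) => t tE tn.
have /existsNP[S /not_implyP[cS noT]] : ~ unavoidable R a d n t.+1.
  move=> un; suff : (t < t)%N by rewrite ltnn.
  by rewrite -{2}tE; apply: (@leq_bigmax_cond _ _ _ (Ordinal (_ : t.+1 < n.+1)%N)) => //; apply/asboolP.
pose pt (i : 'I_n) := (enum_fset S)`_i.
have pt_inj : injective pt.
  move=> i j /eqP; rewrite /pt nth_uniq ?fset_uniq -?cardfE ?cS //; [|by rewrite cS..].
  by move/eqP/val_inj.
have small M : rainbow pt a M -> (#|M| <= t)%N.
  move=> rM; rewrite leqNgt; apply/negP => /subset_card[M' sM cM'].
  apply: noT; exists [fset pt i | i in M']%fset; split.
  - by apply/fsubsetP=> y /imfsetP[i _ ->]; rewrite /pt mem_nth // cS.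
  - by rewrite card_imfset //= -cM' cardE.
  - by apply: rainbow_distinct_volumes (rainbowS sM rM).
apply: (card_bound_rainbow pt_inj a1 _ n0 small).
(* A single point is rainbow, so t is positive. *)
by have := small _ (@rainbow1 _ _ _ pt a (Ordinal n0)); rewrite cards1.
Qed.

End Volume.

Theorem theorem1p2 (R : realType) (a d : nat) :
  (2 <= a <= d + 1)%N ->
  exists c : R, 0 < c /\
    forall n : nat, (0 < n)%N ->
      c * n%:R `^ (1 / ((2 * a%:R - 1) * d%:R)) <= (h R a d n)%:R.
Proof.
move=> /andP[a1 ad]; have d0 : (0 < d)%N by lia.
set C := (rainbow_const a d)%:R : R.
have C0 : 0 < C by rewrite ltr0n !muln_gt0 !expn_gt0; lia.
set e := 1 / _.
have eE : ((2 * a - 1) * d)%:R * e = 1.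
  rewrite /e natrM natrB ?natrM; last by lia.
  rewrite div1r divff // mulf_neq0 ?pnatr_eq0 -?lt0n //.
  by rewrite subr_eq0 -natrM eqr_nat; lia.
have e0 : 0 <= e.
  by rewrite -(pmulr_rge0 _ (_ : 0 < ((2 * a - 1) * d)%:R)) ?eE // ltr0n muln_gt0 d0 andbT; lia.
(* Raising n <= C h^((2a-1)d) to the power e gives n^e <= C^e h. *)
exists (C `^ e)^-1; split; first by rewrite invr_gt0 powR_gt0.
move=> n n0; rewrite mulrC ler_pdivrMr ?powR_gt0 //.
have := h_bound R a1 n0 d0; set t := h R a d n.
rewrite -(ler_nat R) natrM => /(ge0_ler_powR e0); rewrite !nnegrE ?mulr_ge0 // => /(_ (ler0n _ _) isT).
move=> /le_trans; apply; rewrite powRM // mulrC natrX -powR_mulrn // -powRrM eE.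
by rewrite powRr1.
Qed.
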